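(* Let $F$ be a field of characteristic zero, let $Q=\oplus_{i=1}^n\mathbb Z\alpha_i$ be a free abelian group of rank $n$ with basis $\alpha_1,\dots,\alpha_n$, and let $\mathfrak g=\oplus_{\alpha\in Q}\mathfrak g_\alpha$ be a $Q$-graded Lie algebra over $F$. Put $\Delta=\{\alpha\in Q\mid \mathfrak g_\alpha\neq 0\}$. Assume that: (1) $\mathbb Z\alpha_1\cap\Delta=\{0,\pm\alpha_1\}$; (2) $L=\mathfrak g_{\alpha_1}\oplus[\mathfrak g_{\alpha_1},\mathfrak g_{-\alpha_1}]\oplus\mathfrak g_{-\alpha_1}$ is a subalgebra of $\mathfrak g$ and $(\mathfrak g_{\alpha_1},\mathfrak g_{-\alpha_1})$ is a plus-minus pair of $L$; (3) there is a subalgebra $\mathfrak g_0'$ of $\mathfrak g_0$ with $\mathfrak g_0=[\mathfrak g_{\alpha_1},\mathfrak g_{-\alpha_1}]\oplus\mathfrak g_0'$ (direct sum of vector spaces). Call $\alpha=\sum_{i=1}^n c_i\alpha_i\in Q$ positive (resp. negative) if there is an index $i$ with $c_i>0$ (resp. $c_i<0$) and $c_{i+1}=c_{i+2}=\dots=c_n=0$. Let $\Delta_+$ (resp. $\Delta_-$) be the set of positive (resp. negative) elements of $\Delta$, and let $\mathfrak g_\pm=\oplus_{\alpha\in\Delta_\pm}\mathfrak g_\alpha$. Then $$U(\mathfrak g)=U(\mathfrak g_{\alpha_1})\,U(\mathfrak g_-)\,U(\mathfrak g_0')\,U(\mathfrak g_+).$$ Moreover, letting $P=\mathfrak g_+\oplus\mathfrak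 g_0'$ and $M=\mathfrak g_-$ gives a plus-minus pair $(P,M)$ for $\mathfrak g$.
   Context: For a Lie algebra $\mathfrak a$ over $F$, $U(\mathfrak a)$ denotes its universal enveloping algebra; for a subalgebra $\mathfrak b\subseteq\mathfrak a$, $U(\mathfrak b)$ is regarded as a subalgebra of $U(\mathfrak a)$. For subspaces $A,B$ of $U(\mathfrak a)$, $AB$ denotes the linear span of all products $ab$ with $a\in A$, $b\in B$. A Lie algebra $L$ has a plus-minus pair $(P,M)$ if $P,M$ are subalgebras of $L$ with $P+M\neq L$ (vector space sum) and $U(L)=U(P)U(M)U(P)$. $Q$-graded means $[\mathfrak g_\alpha,\mathfrak g_\beta]\subseteq\mathfrak g_{\alpha+\beta}$ for all $\alpha,\beta\in Q$; $[\mathfrak g_{\alpha_1},\mathfrak g_{-\alpha_1}]$ denotes the linear span of the brackets. *)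

(* Defs.v *)
From HB Require Import structures.
From mathcomp Require Import all_boot all_order all_algebra.
From mathcomp Require Import all_classical.

Set Implicit Arguments.
Unset Strict Implicit.
Unset Printing Implicit Defensive.

Import GRing.Theory.

Local Open Scope classical_set_scope.
Local Open Scope quotient_scope.
Local Open Scope ring_scope.

HB.mixin Record Lmodule_isLieAlgebra (F : fieldType) (g : Type)
    of GRing.Lmodule F g := {
  lie : g -> g -> g;
  lie_linearl : forall a x y z, lie (a *: x + y) z = a *: lie x z + lie y z;
  lie_linearr : forall a x y z, lie z (a *: x + y) = a *: lie z x + lie z y;
  liexx : forall x, lie x x = 0;
  lie_jacobi : forall x y z,
    lie x (lie y z) + lie y (lie z x) + lie z (lie x y) = 0
}.

#[short(type="lieAlgType")]
HB.structure Definition LieAlgebra (F : fieldType) :=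
  {g of Lmodule_isLieAlgebra F g & GRing.Lmodule F g}.

Section Subspaces.
Variables (F : fieldType) (V : lmodType F).

Definition subspace (A : set V) : Prop := GRing.submod_closed (mem A).

Definition lspan (A : set V) : set V := smallest subspace A.

Definition sumset (A B : set V) : set V := [set x + y | x in A & y in B].

(* Internal direct sum of a possibly infinite family. *)
Definition dsum (I : eqType) (A : I -> set V) (C : set V) : Prop :=
  C = lspan (\bigcup_i A i) /\
  forall (s : seq I) (x : I -> V), uniq s ->
    (forall i, i \in s -> A i (x i)) ->
    \sum_(i <- s) x i = 0 -> forall i, i \in s -> x i = 0.

Definition dsum_seq (s : seq (set V)) (C : set V) : Prop :=
  dsum (fun i : 'I_(size s) => nth set0 s i) C.

End Subspaces.

Section LieSubalgebras.
Variables (F : fieldType) (g : lieAlgType F).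

Definition lie_closed (A : set g) : Prop :=
  forall x y, A x -> A y -> A (lie x y).

Definition lie_subalgebra (A : set g) : Prop := subspace A /\ lie_closed A.

Definition lie_span (A B : set g) : set g := lspan [set lie x y | x in A & y in B].

Record subLie := SubLie {
  subLie_set :> set g;
  subLieP : lie_subalgebra subLie_set
}.

End LieSubalgebras.

Section SubLieAlgebra.
Variables (F : fieldType) (g : lieAlgType F) (L : subLie g).

Definition subLie_pred : pred g := fun x => x \in subLie_set L.

Fact subLie_submod_closed : GRing.submod_closed subLie_pred.
Proof. by have [[? ?] _] := subLieP L. Qed.

HB.instance Definition _ :=
  GRing.isSubmodClosed.Build F g subLie_pred subLie_submod_closed.

Record subLieType := SubLieElt {
  subLie_val : g;
  subLie_valP : subLie_pred subLie_val
}.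

HB.instance Definition _ := [isSub for subLie_val].
HB.instance Definition _ := [Choice of subLieType by <:].
HB.instance Definition _ := [SubChoice_isSubLmodule of subLieType by <:].

Fact sub_lie_subproof (x y : subLieType) :
  subLie_pred (lie (subLie_val x) (subLie_val y)).
Proof.
have [_ LL] := subLieP L.
by apply/mem_set/LL; apply/set_mem/subLie_valP.
Qed.

Definition sub_lie (x y : subLieType) : subLieType :=
  SubLieElt (sub_lie_subproof x y).

Fact sub_lie_linearl a x y z :
  sub_lie (a *: x + y) z = a *: sub_lie x z + sub_lie y z.
Proof. by apply: val_inj; rewrite linearP; apply: lie_linearl. Qed.

Fact sub_lie_linearr a x y z :
  sub_lie z (a *: x + y) = a *: sub_lie z x + sub_lie z y.
Proof. by apply: val_inj; rewrite linearP; apply: lie_linearr. Qed.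

Fact sub_liexx x : sub_lie x x = 0.
Proof. by apply: val_inj; rewrite raddf0; apply: liexx. Qed.

Fact sub_lie_jacobi x y z :
  sub_lie x (sub_lie y z) + sub_lie y (sub_lie z x) + sub_lie z (sub_lie x y)
  = 0.
Proof. by apply: val_inj; rewrite raddf0; apply: lie_jacobi. Qed.

HB.instance Definition _ := Lmodule_isLieAlgebra.Build F subLieType
  sub_lie_linearl sub_lie_linearr sub_liexx sub_lie_jacobi.

End SubLieAlgebra.

Arguments subLieType {F g} L.

(* [env g] is the unital associative F-algebra presented by the generators
   x in g and the relations saying that the map g -> env g is F-linear and
   sends [x, y] to xy - yx. It is built as the quotient of the formal
   expressions over g and F by the congruence [eqv] generated by the algebra
   axioms and these relations. *)

Section Enveloping.
Variables (F : fieldType) (g : lieAlgType F).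

Inductive expr : Type :=
| Gen of g
| Scal of F
| Add of expr & expr
| Mul of expr & expr.

Definition Opp (e : expr) : expr := Mul (Scal (-1)) e.

Inductive eqv : expr -> expr -> Prop :=
| eqv_refl e : eqv e e
| eqv_sym e1 e2 : eqv e1 e2 -> eqv e2 e1
| eqv_trans e2 e1 e3 : eqv e1 e2 -> eqv e2 e3 -> eqv e1 e3
| eqv_Add e1 e1' e2 e2' : eqv e1 e1' -> eqv e2 e2' ->
    eqv (Add e1 e2) (Add e1' e2')
| eqv_Mul e1 e1' e2 e2' : eqv e1 e1' -> eqv e2 e2' ->
    eqv (Mul e1 e2) (Mul e1' e2')
| eqv_AddA e1 e2 e3 : eqv (Add e1 (Add e2 e3)) (Add (Add e1 e2) e3)
| eqv_AddC e1 e2 : eqv (Add e1 e2) (Add e2 e1)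
| eqv_Add0 e : eqv (Add (Scal 0) e) e
| eqv_AddN e : eqv (Add (Opp e) e) (Scal 0)
| eqv_MulA e1 e2 e3 : eqv (Mul e1 (Mul e2 e3)) (Mul (Mul e1 e2) e3)
| eqv_Mul1l e : eqv (Mul (Scal 1) e) e
| eqv_MulDl e1 e2 e3 : eqv (Mul (Add e1 e2) e3) (Add (Mul e1 e3) (Mul e2 e3))
| eqv_MulDr e1 e2 e3 : eqv (Mul e1 (Add e2 e3)) (Add (Mul e1 e2) (Mul e1 e3))
| eqv_ScalD a b : eqv (Scal (a + b)) (Add (Scal a) (Scal b))
| eqv_ScalM a b : eqv (Scal (a * b)) (Mul (Scal a) (Scal b))
| eqv_ScalC a e : eqv (Mul (Scal a) e) (Mul e (Scal a))
| eqv_GenP a x y : eqv (Gen (a *: x + y)) (Add (Mul (Scal a) (Gen x)) (Gen y))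
| eqv_GenL x y :
    eqv (Gen (lie x y))
        (Add (Mul (Gen x) (Gen y)) (Opp (Mul (Gen y) (Gen x)))).

HB.instance Definition _ := gen_eqMixin expr.
HB.instance Definition _ := gen_choiceMixin expr.

Definition eqvb : rel expr := fun e1 e2 => `[< eqv e1 e2 >].

Fact eqvb_equiv : equiv_class_of eqvb.
Proof.
split=> [e|e1 e2|e2 e1 e3].
- exact/asboolP/eqv_refl.
- by apply/idP/idP => /asboolP h; apply/asboolP/eqv_sym.
- by move=> /asboolP h1 /asboolP h2; apply/asboolP/(eqv_trans h1 h2).
Qed.

Canonical eqvb_equivRel := EquivRelPack eqvb_equiv.

Definition env : Type := {eq_quot eqvb}.
HB.instance Definition _ := Choice.on env.
HB.instance Definition _ := EqQuotient.on env.

Definition env_pi (e : expr) : env := \pi_env e.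

Lemma env_piP e1 e2 : eqv e1 e2 <-> env_pi e1 = env_pi e2.
Proof.
split=> [h|/eqquotP/asboolP //].
by apply/eqquotP/asboolP.
Qed.

Lemma env_ind (P : env -> Prop) : (forall e, P (env_pi e)) -> forall u, P u.
Proof. by move=> h u; rewrite -[u]reprK; apply: h. Qed.

Lemma eqv_repr e : eqv (repr (env_pi e)) e.
Proof. by apply/env_piP; rewrite /env_pi reprK. Qed.

Definition env_add (u v : env) : env := env_pi (Add (repr u) (repr v)).
Definition env_mul (u v : env) : env := env_pi (Mul (repr u) (repr v)).
Definition env_scalar (a : F) : env := env_pi (Scal a).
Definition env_opp (u : env) : env := env_mul (env_scalar (-1)) u.

Lemma env_addE e1 e2 : env_add (env_pi e1) (env_pi e2) = env_pi (Add e1 e2).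
Proof. by apply/env_piP/eqv_Add; apply: eqv_repr. Qed.

Lemma env_mulE e1 e2 : env_mul (env_pi e1) (env_pi e2) = env_pi (Mul e1 e2).
Proof. by apply/env_piP/eqv_Mul; apply: eqv_repr. Qed.

Definition envE := (env_addE, env_mulE).

Local Opaque env_add env_mul.

Fact env_addA : associative env_add.
Proof.
elim/env_ind=> a; elim/env_ind=> b; elim/env_ind=> c.
by rewrite !envE; apply/env_piP/eqv_AddA.
Qed.

Fact env_addC : commutative env_add.
Proof.
elim/env_ind=> a; elim/env_ind=> b.
by rewrite !envE; apply/env_piP/eqv_AddC.
Qed.

Fact env_add0 : left_id (env_scalar 0) env_add.
Proof. by elim/env_ind=> a; rewrite !envE; apply/env_piP/eqv_Add0. Qed.

Fact env_addN : left_inverse (env_scalar 0) env_opp env_add.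
Proof.
by elim/env_ind=> a; rewrite /env_opp /env_scalar !envE; apply/env_piP/eqv_AddN.
Qed.

HB.instance Definition _ :=
  GRing.isZmodule.Build env env_addA env_addC env_add0 env_addN.

Fact env_mulA : associative env_mul.
Proof.
elim/env_ind=> a; elim/env_ind=> b; elim/env_ind=> c.
by rewrite !envE; apply/env_piP/eqv_MulA.
Qed.

Fact env_mul1l : left_id (env_scalar 1) env_mul.
Proof. by elim/env_ind=> a; rewrite !envE; apply/env_piP/eqv_Mul1l. Qed.

Fact env_mulC a u : env_mul (env_scalar a) u = env_mul u (env_scalar a).
Proof. by move: u; elim/env_ind=> u; rewrite !envE; apply/env_piP/eqv_ScalC. Qed.

Fact env_mul1r : right_id (env_scalar 1) env_mul.
Proof. by move=> u; rewrite -env_mulC env_mul1l. Qed.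

Fact env_mulDl : left_distributive env_mul +%R.
Proof.
elim/env_ind=> a; elim/env_ind=> b; elim/env_ind=> c.
by rewrite /GRing.add /= !envE; apply/env_piP/eqv_MulDl.
Qed.

Fact env_mulDr : right_distributive env_mul +%R.
Proof.
elim/env_ind=> a; elim/env_ind=> b; elim/env_ind=> c.
by rewrite /GRing.add /= !envE; apply/env_piP/eqv_MulDr.
Qed.

(* The augmentation, which shows that env g is not the zero ring. *)
Fixpoint aug (e : expr) : F :=
  match e with
  | Gen _ => 0
  | Scal a => a
  | Add e1 e2 => aug e1 + aug e2
  | Mul e1 e2 => aug e1 * aug e2
  end.

Fact aug_eqv e1 e2 : eqv e1 e2 -> aug e1 = aug e2.
Proof.
elim=> //= *.
- by congruence.
- by congruence.
- by congruence.
- by rewrite addrA.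
- by rewrite addrC.
- by rewrite add0r.
- by rewrite mulN1r addNr.
- by rewrite mulrA.
- by rewrite mul1r.
- by rewrite mulrDl.
- by rewrite mulrDr.
- by rewrite mulrC.
- by rewrite mulr0 addr0.
- by rewrite !mulr0 addr0.
Qed.

Fact env_1neq0 : env_scalar 1 != 0.
Proof. by apply/eqP => /env_piP/aug_eqv /= /eqP; rewrite oner_eq0. Qed.

HB.instance Definition _ := GRing.Zmodule_isNzRing.Build env
  env_mulA env_mul1l env_mul1r env_mulDl env_mulDr env_1neq0.

Definition env_scale (a : F) (u : env) : env := env_mul (env_scalar a) u.

Fact env_scaleA a b u : env_scale a (env_scale b u) = env_scale (a * b) u.
Proof.
rewrite /env_scale env_mulA; congr env_mul.
by rewrite !envE; apply/env_piP/eqv_sym/eqv_ScalM.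
Qed.

Fact env_scale1 : left_id 1 env_scale.
Proof. exact: env_mul1l. Qed.

Fact env_scaleDr : right_distributive env_scale +%R.
Proof. by move=> a u v; apply: env_mulDr. Qed.

Fact env_scaleDl u : {morph env_scale^~ u : a b / a + b}.
Proof.
move=> a b; rewrite /env_scale -env_mulDl; congr env_mul.
by rewrite /GRing.add /= !envE; apply/env_piP/eqv_ScalD.
Qed.

HB.instance Definition _ := GRing.Zmodule_isLmodule.Build F env
  env_scaleA env_scale1 env_scaleDr env_scaleDl.

Fact env_scaleAl a (u v : env) : a *: (u * v) = a *: u * v.
Proof. exact: env_mulA. Qed.

HB.instance Definition _ := GRing.Lmodule_isLalgebra.Build F env env_scaleAl.

Fact env_scaleAr a (u v : env) : a *: (u * v) = u * (a *: v).
Proof.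
by rewrite env_scaleAl [a *: u]env_mulC -[LHS]env_mulA.
Qed.

HB.instance Definition _ := GRing.Lalgebra_isAlgebra.Build F env env_scaleAr.

Definition env_in (x : g) : env := env_pi (Gen x).

Fact env_in_linear : linear env_in.
Proof.
move=> a x y; rewrite /env_in /GRing.scale /= /env_scale /env_scalar.
by rewrite /GRing.add /= !envE; apply/env_piP/eqv_GenP.
Qed.

HB.instance Definition _ := GRing.isLinear.Build F g env *:%R env_in
  env_in_linear.

Lemma env_in_lie x y :
  env_in (lie x y) = env_in x * env_in y - env_in y * env_in x.
Proof.
rewrite /env_in /GRing.opp /= /env_opp /env_scalar.
by rewrite /GRing.mul /= /GRing.add /= !envE; apply/env_piP/eqv_GenL.
Qed.

Section UniversalProperty.
Variables (A : algType F) (phi : {linear g -> A}).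
Hypothesis phi_lie :
  forall x y, phi (lie x y) = phi x * phi y - phi y * phi x.

Fixpoint eval (e : expr) : A :=
  match e with
  | Gen x => phi x
  | Scal a => a%:A
  | Add e1 e2 => eval e1 + eval e2
  | Mul e1 e2 => eval e1 * eval e2
  end.

Fact eval_eqv e1 e2 : eqv e1 e2 -> eval e1 = eval e2.
Proof.
elim=> //= *.
- by congruence.
- by congruence.
- by congruence.
- by rewrite addrA.
- by rewrite addrC.
- by rewrite scale0r add0r.
- by rewrite -scalerAl mul1r scaleN1r addNr scale0r.
- by rewrite mulrA.
- by rewrite scale1r mul1r.
- by rewrite mulrDl.
- by rewrite mulrDr.
- by rewrite scalerDl.
- by rewrite -scalerAl mul1r scalerA.
- by rewrite -scalerAl -scalerAr mul1r mulr1.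
- by rewrite linearP -scalerAl mul1r.
- by rewrite phi_lie -scalerAl mul1r scaleN1r.
Qed.

Definition env_lift (u : env) : A := eval (repr u).

Lemma env_liftE e : env_lift (env_pi e) = eval e.
Proof. exact/eval_eqv/eqv_repr. Qed.

Lemma env_lift_in x : env_lift (env_in x) = phi x.
Proof. exact: env_liftE. Qed.

Fact env_lift_linear : linear env_lift.
Proof.
move=> a; elim/env_ind=> u; elim/env_ind=> v.
rewrite {1}/GRing.scale /= /env_scale /env_scalar.
rewrite {1}/GRing.add /= !envE !env_liftE /=.
by rewrite -scalerAl mul1r.
Qed.

Fact env_lift_monoid : monoid_morphism env_lift.
Proof.
split.
  by rewrite -[LHS]/(env_lift (env_pi (Scal 1))) env_liftE /= scale1r.
elim/env_ind=> u; elim/env_ind=> v.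
by rewrite {1}/GRing.mul /= !envE !env_liftE.
Qed.

HB.instance Definition _ := GRing.isLinear.Build F env A *:%R env_lift
  env_lift_linear.
HB.instance Definition _ := GRing.isMonoidMorphism.Build env A env_lift
  env_lift_monoid.

Lemma env_universal :
  exists f : {lrmorphism env -> A}, (forall x, f (env_in x) = phi x) /\
    forall f' : {lrmorphism env -> A},
      (forall x, f' (env_in x) = phi x) -> f' =1 f.
Proof.
exists env_lift; split=> [|f' f'E]; first exact: env_lift_in.
elim/env_ind=> e; apply: etrans (esym (env_liftE e)).
elim: e => [x|a|e1 IH1 e2 IH2|e1 IH1 e2 IH2] /=.
- exact: f'E.
- rewrite -(rmorph1 f') -linearZ; congr (f' _).
  rewrite /GRing.scale /= /env_scale [1]/(env_scalar 1).
  by rewrite env_mul1r.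
- by rewrite -IH1 -IH2 -rmorphD; congr (f' _); rewrite /GRing.add /= !envE.
- by rewrite -IH1 -IH2 -rmorphM; congr (f' _); rewrite /GRing.mul /= !envE.
Qed.

End UniversalProperty.

(* U(b) regarded as a subalgebra of U(g), for a subalgebra b of g. *)
Definition env_sub (b : set g) : set env :=
  smallest (fun B : set env => GRing.subalg_closed (mem B)) (env_in @` b).

Definition env_prod (A B : set env) : set env :=
  lspan [set u * v | u in A & v in B].

Definition plus_minus_pair (P M : set g) : Prop :=
  [/\ lie_subalgebra P, lie_subalgebra M, sumset P M <> setT &
      setT = env_prod (env_prod (env_sub P) (env_sub M)) (env_sub P)].

End Enveloping.

(* The free abelian group of rank n is 'rV[int]_n, with basis delta_mx 0 i. *)

Section Gradings.
Variables (n : nat) (F : fieldType) (g : lieAlgType F).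
Implicit Types (gr : 'rV[int]_n -> set g).

Definition Q_graded gr : Prop :=
  [/\ forall a, subspace (gr a), dsum gr setT &
      forall a b x y, gr a x -> gr b y -> gr (a + b) (lie x y)].

Definition weights gr : set 'rV[int]_n := [set a | gr a <> [set 0]].

Definition positive (c : 'rV[int]_n) : Prop :=
  exists i, 0 < c 0 i /\ forall j : 'I_n, (i < j)%N -> c 0 j = 0.

Definition negative (c : 'rV[int]_n) : Prop :=
  exists i, c 0 i < 0 /\ forall j : 'I_n, (i < j)%N -> c 0 j = 0.

Definition graded_part gr (S : set 'rV[int]_n) : set g :=
  lspan (\bigcup_(a in S) gr a).

End Gradings.

(* Main.v *)
Require Import Defs.
From HB Require Import structures.
From mathcomp Require Import all_boot all_order all_algebra.
From mathcomp Require Import all_classical.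

(* Write E = g_{alpha1}, H = [E, g_{-alpha1}], and let N+- be the sum of the
   g_a over the weights a outside Z alpha1 that are positive (negative). The
   spanning half of Poincare-Birkhoff-Witt gives U(A + B) = U(A) U(B) whenever
   A, B and A + B are subalgebras, hence
     U(g) = U(N-) U(L + g0') U(N+) = U(N-) U(E) U(g_{-alpha1}) U(E) U(g0') U(N+),
   where the plus-minus pair of L was used. As E normalizes N- and g0'
   normalizes E, the first U(E) moves left past U(N-) and the second moves right
   past U(g0'), giving U(E) U(g-) U(g0') U(g+). Finally P + M = g would force
   H = 0, i.e. L = E + g_{-alpha1}, which the plus-minus pair excludes. *)

Set Implicit Arguments.
Unset Strict Implicit.
Unset Printing Implicit Defensive.

Import Order.TTheory GRing.Theory Num.Theory.

Local Open Scope classical_set_scope.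
Local Open Scope ring_scope.

(** * Subspaces, sums of subspaces and internal direct sums *)

Section Subspaces.
Variables (F : fieldType) (V : lmodType F).
Implicit Types A B C : set V.

Lemma subspaceP A :
  subspace A <-> A 0 /\ forall a x y, A x -> A y -> A (a *: x + y).
Proof.
split=> [[A0 AP]|[A0 AP]]; split=> [|a x y].
- exact: set_mem A0.
- by move=> /mem_set Ax /mem_set Ay; apply/set_mem/AP.
- exact: mem_set.
- by move=> /set_mem Ax /set_mem Ay; apply/mem_set/AP.
Qed.

Lemma subspace0 A : subspace A -> A 0.
Proof. by case/subspaceP. Qed.

Lemma subspaceZD A : subspace A -> forall a x y, A x -> A y -> A (a *: x + y).
Proof. by case/subspaceP. Qed.

Lemma subspaceD A x y : subspace A -> A x -> A y -> A (x + y).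
Proof. by move=> /subspaceZD/(_ 1 x y); rewrite scale1r. Qed.

Lemma subspaceZ A a x : subspace A -> A x -> A (a *: x).
Proof.
move=> sA Ax; rewrite -[_ *: _]addr0.
by apply: subspaceZD => //; apply: subspace0.
Qed.

Lemma subspaceN A x : subspace A -> A x -> A (- x).
Proof. by rewrite -scaleN1r; apply: subspaceZ. Qed.

Lemma lspan_subspace A : subspace (lspan A).
Proof.
apply/subspaceP; split=> [B [sB _]|a x y Ax Ay B [sB AB]].
  exact: subspace0.
by apply: subspaceZD => //; [apply: Ax|apply: Ay].
Qed.

Lemma sub_lspan A : A `<=` lspan A.
Proof. exact: sub_gen_smallest. Qed.

Lemma lspan_sub A B : subspace B -> A `<=` B -> lspan A `<=` B.
Proof. by move=> sB AB; apply: smallest_sub. Qed.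

Lemma sumset_subspace A B : subspace A -> subspace B -> subspace (sumset A B).
Proof.
move=> sA sB; apply/subspaceP; split.
  by exists 0; [exact: subspace0|exists 0; [exact: subspace0|rewrite addr0]].
move=> a _ _ [x Ax [y By <-]] [x' Ax' [y' By' <-]].
exists (a *: x + x'); first exact: subspaceZD.
exists (a *: y + y'); first exact: subspaceZD.
by rewrite scalerDr addrACA.
Qed.

Lemma sumsetC A B : sumset A B = sumset B A.
Proof.
by apply/seteqP; split=> _ [x Ax [y By <-]]; exists y => //; exists x => //;
   rewrite addrC.
Qed.

Lemma sub_sumsetl A B : subspace B -> A `<=` sumset A B.
Proof.
by move=> sB x Ax; exists x => //; exists 0; [exact: subspace0|rewrite addr0].
Qed.

Lemma sub_sumsetr A B : subspace A -> B `<=` sumset A B.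
Proof. by move=> sA; rewrite sumsetC; apply: sub_sumsetl. Qed.

Lemma sumset_sub A B C :
  subspace C -> A `<=` C -> B `<=` C -> sumset A B `<=` C.
Proof.
move=> sC leAC leBC _ [x Ax [y By <-]].
by apply: subspaceD => //; [apply: leAC|apply: leBC].
Qed.

Lemma dsum_seq_sub (s : seq (set V)) C i :
  dsum_seq s C -> (i < size s)%N -> nth set0 s i `<=` C.
Proof.
move=> [-> _] lti x sx; apply: sub_lspan.
by exists (Ordinal lti).
Qed.

Lemma dsum_seq_min (s : seq (set V)) B C :
  dsum_seq s C -> subspace B ->
  (forall i, (i < size s)%N -> nth set0 s i `<=` B) -> C `<=` B.
Proof.
move=> [-> _] sB sub; apply: lspan_sub => // x [i _]; exact: sub.
Qed.

(** A relation x0 + x1 = 0 puts x0 = - x1 in both subspaces. This supplies the directness of [P]. *)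
Lemma dsum_seq2 A B : subspace A -> subspace B ->
  (forall x, A x -> B x -> x = 0) -> dsum_seq [:: A; B] (sumset A B).
Proof.
move=> sA sB AB0; split.
  apply/seteqP; split.
    apply: sumset_sub; first exact: lspan_subspace.
      by move=> x Ax; apply: sub_lspan; exists ord0.
    by move=> x Bx; apply: sub_lspan; exists (lift ord0 ord0).
  apply: lspan_sub; first exact: sumset_subspace.
  move=> x [[[|[|i]] lti] _] //=; first exact: sub_sumsetl.
  exact: sub_sumsetr.
(* An index missing from [s] contributes 0, so any duplicate-free list reduces to the sum over both
   indices. *)
move=> s x us sx; rewrite big_uniq //= big_mkcond big_ord_recl big_ord1 /=.
set i0 := ord0; set i1 := lift _ _.
have x0A : A (if i0 \in s then x i0 else 0).
  by case: ifP => [/sx//|_]; apply: subspace0.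
have x1B : B (if i1 \in s then x i1 else 0).
  by case: ifP => [/sx//|_]; apply: subspace0.
move: x0A x1B; set x0 := (if i0 \in s then _ else _).
set x1 := (if i1 \in s then _ else _).
move=> Ax0 Bx1 /eqP; rewrite addr_eq0 => /eqP x01.
have x00 : x0 = 0 by apply: AB0 => //; rewrite x01; apply: subspaceN.
have x10 : x1 = 0 by apply/eqP; rewrite -oppr_eq0 -x01 x00.
move=> i si; move: x00 x10; rewrite /x0 /x1.
have : (i == i0) || (i == i1) by case: i {si} => -[|[|i]].
by case/orP => /eqP <-; rewrite si.
Qed.

(** Independence is applied to the family (x, - x), whose sum vanishes. *)
Lemma dsum_seq2_disj A B C x : subspace B ->
  dsum_seq [:: A; B] C -> A x -> B x -> x = 0.
Proof.
move=> sB [_ ind] Ax Bx.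
pose i0 : 'I_2 := ord0; pose i1 : 'I_2 := lift ord0 ord0.
pose w (i : 'I_2) := if i == i0 then x else - x.
have -> : x = w i0 by [].
apply: (ind [:: i0; i1] w) => //.
- by move=> i; rewrite !inE; case/orP => /eqP -> //=; apply: subspaceN.
- by rewrite !big_cons big_nil addr0 /w /= subrr.
Qed.

(** The list has no duplicates and [y] vanishes off it, so two such expressions extend to a common
    list and can be combined term by term there. *)
Lemma family_spanP (I : eqType) (A : I -> set V) (S : set I) x :
  (forall i, subspace (A i)) -> lspan (\bigcup_(i in S) A i) x ->
  exists (s : seq I) (y : I -> V),
    [/\ uniq s, forall i, i \in s -> S i, forall i, A i (y i),
        forall i, i \notin s -> y i = 0 & x = \sum_(i <- s) y i].
Proof.
move=> sA; move: x; apply: lspan_sub; last first.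
  move=> x [i Si Ax]; exists [:: i], (fun j => if j == i then x else 0).
  split=> //.
  - by move=> j; rewrite inE => /eqP ->.
  - by move=> j; case: eqP => [->|_] //; apply: subspace0.
  - by move=> j; rewrite inE => /negbTE ->.
  - by rewrite big_seq1 eqxx.
(* The indices of [t] outside [s] only add zero terms. *)
have widen (s t : seq I) (y : I -> V) : uniq s -> uniq t -> {subset s <= t} ->
    (forall i, i \notin s -> y i = 0) -> \sum_(i <- s) y i = \sum_(i <- t) y i.
  move=> us ut st y0; rewrite [RHS](bigID (mem s)) /= [X in _ + X]big1 ?addr0.
    rewrite -[RHS]big_filter; apply: perm_big; apply: uniq_perm => //.
      exact: filter_uniq.
    move=> i; rewrite mem_filter /=; case si: (i \in s) => //=.
    by rewrite st.
  by move=> i /y0.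
apply/subspaceP; split.
  exists [::], (fun=> 0); split => //; last by rewrite big_nil.
  by move=> i; apply: subspace0.
move=> a _ _ [s [y [us Ss Ay y0 ->]]] [t [z [ut St Az z0 ->]]].
have ust := undup_uniq (s ++ t).
exists (undup (s ++ t)), (fun i => a *: y i + z i); split => //.
- by move=> i; rewrite mem_undup mem_cat => /orP[/Ss|/St].
- by move=> i; apply: subspaceZD.
- move=> i; rewrite mem_undup mem_cat negb_or => /andP[/y0 -> /z0 ->].
  by rewrite scaler0 addr0.
rewrite big_split /= -scaler_sumr; congr (_ *: _ + _); apply: widen => //.
  by move=> i si; rewrite mem_undup mem_cat si.
by move=> i si; rewrite mem_undup mem_cat si orbT.
Qed.

(** Expand x over indices in [S] and - x over indices in [T]. Concatenated, these form a vanishing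
    sum over distinct indices, so each term is 0. *)
Lemma dsum_disj (I : eqType) (A : I -> set V) C (S T : set I) x :
  (forall i, subspace (A i)) -> dsum A C -> S `&` T = set0 ->
  lspan (\bigcup_(i in S) A i) x -> lspan (\bigcup_(i in T) A i) x -> x = 0.
Proof.
move=> sA [_ ind] ST0 /(family_spanP sA)[s [y [us Ss Ay _ xy]]].
move=> /(family_spanP sA)[t [z [ut Tt Az _ xz]]].
have stN i : i \in s -> i \notin t.
  move=> si; apply/negP => ti; suff : (S `&` T) i by rewrite ST0.
  by split; [apply: Ss|apply: Tt].
pose w i := if i \in s then y i else - z i.
have sw : \sum_(i <- s) w i = x.
  by rewrite xy big_seq [RHS]big_seq; apply: eq_bigr => i; rewrite /w => ->.
have tw : \sum_(i <- t) w i = - x.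
  rewrite xz -sumrN big_seq [RHS]big_seq; apply: eq_bigr => i ti.
  by rewrite /w ifN //; apply: contraL ti; apply: stN.
rewrite -sw big_seq big1 // => i si; apply: (ind (s ++ t) w) => //.
- rewrite cat_uniq us ut andbT /=; apply/hasPn => j tj.
  by apply: contraL tj; apply: stN.
- by move=> j _; rewrite /w; case: ifP => // _; apply: subspaceN.
- by rewrite big_cat /= sw tw subrr.
- by rewrite mem_cat si.
Qed.

End Subspaces.

(** * Subalgebras U(A) of U(g) and their products *)

Definition subalgebra (F : fieldType) (R : algType F) (X : set R) : Prop :=
  GRing.subalg_closed (mem X).

Lemma subalgebraP (F : fieldType) (R : algType F) (X : set R) :
  subalgebra X <->
  [/\ X 1, subspace X & forall u v, X u -> X v -> X (u * v)].
Proof.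
split=> [[X1 XP XM]|[X1 XP XM]].
  have X1' : X 1 := set_mem X1.
  have XP' a x y : X x -> X y -> X (a *: x + y).
    by move=> /mem_set Xx /mem_set Xy; apply/set_mem/XP.
  split=> // [|u v /mem_set Xu /mem_set Xv]; last exact/set_mem/XM.
  apply/subspaceP; split=> //.
  (* [subalg_closed] does not list 0, which is obtained as (-1) 1 + 1. *)
  by have := XP' (-1) 1 1 X1' X1'; rewrite scaleN1r addNr.
split=> [|a u v /set_mem Xu /set_mem Xv|u v /set_mem Xu /set_mem Xv].
- exact: mem_set.
- exact/mem_set/(subspaceZD XP).
- exact/mem_set/XM.
Qed.

Section Enveloping.
Variables (F : fieldType) (g : lieAlgType F).
Implicit Types (A B C : set g) (X Y Z : set (env g)).

Lemma env_sub_subalgebra A : subalgebra (env_sub A).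
Proof.
apply/subalgebraP; split=> [X [/subalgebraP[]//]||u v Xu Xv X [sX AX]].
  apply/subspaceP; split=> [X [/subalgebraP[_ sX _] _]|a x y Xx Xy X [sX AX]].
    exact: subspace0.
  have [_ sX' _] := (subalgebraP X).1 sX.
  by apply: subspaceZD => //; [apply: Xx|apply: Xy].
have [_ _ XM] := (subalgebraP X).1 sX.
by apply: XM; [apply: Xu|apply: Xv].
Qed.

Lemma env_sub1 A : env_sub A 1.
Proof. by have /subalgebraP[] := env_sub_subalgebra A. Qed.

Lemma env_sub_subspace A : subspace (env_sub A).
Proof. by have /subalgebraP[] := env_sub_subalgebra A. Qed.

Lemma env_subM A u v : env_sub A u -> env_sub A v -> env_sub A (u * v).
Proof. by have /subalgebraP[_ _] := env_sub_subalgebra A; apply. Qed.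

Lemma env_sub_in A x : A x -> env_sub A (env_in x).
Proof. by move=> Ax; apply: sub_gen_smallest; exists x. Qed.

Lemma env_sub_min A X :
  subalgebra X -> (forall x, A x -> X (env_in x)) -> env_sub A `<=` X.
Proof. by move=> sX AX; apply: smallest_sub => // _ [x /AX ? <-]. Qed.

Lemma env_subS A B : A `<=` B -> env_sub A `<=` env_sub B.
Proof.
move=> AB; apply: env_sub_min; first exact: env_sub_subalgebra.
by move=> x /AB; apply: env_sub_in.
Qed.

(** The elements u with u X inside X form a subalgebra, so it is enough to test the generators of
    U(A). *)
Lemma env_sub_stable A X : subspace X ->
  (forall x u, A x -> X u -> X (env_in x * u)) ->
  forall u v, env_sub A u -> X v -> X (u * v).
Proof.
move=> sX AX u v Au; move: u Au v.
apply: (@env_sub_min A [set u | forall v, X v -> X (u * v)]) => [|x Ax v];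
  last exact: AX.
apply/subalgebraP; split=> [v|| u u' Xu Xu' v Xv] /=; first by rewrite mul1r.
  apply/subspaceP; split=> [v _|a u u' Xu Xu' v Xv] /=.
    by rewrite mul0r; apply: subspace0.
  rewrite mulrDl -scalerAl; apply: subspaceZD => //; [exact: Xu|exact: Xu'].
by rewrite -mulrA; apply/Xu/Xu'.
Qed.

(** Induction on a formal expression representing the element; the class of [Scal a] is a times
    1. *)
Lemma env_subT : env_sub [set: g] = setT.
Proof.
apply/seteqP; split=> // u _.
have /subalgebraP[U1 sU UM] := env_sub_subalgebra [set: g].
elim/env_ind: u; elim=> [x|a|e1 IH1 e2 IH2|e1 IH1 e2 IH2].
- exact: env_sub_in.
- suff -> : env_pi (Scal g a) = a *: 1 by apply: (subspaceZ a sU U1).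
  by rewrite /GRing.scale /= /env_scale [1]/(env_scalar g 1) env_mul1r.
- by have := subspaceD sU IH1 IH2; rewrite /GRing.add /= env_addE.
- by have := UM _ _ IH1 IH2; rewrite /GRing.mul /= env_mulE.
Qed.

Lemma env_prod_subspace X Y : subspace (env_prod X Y).
Proof. exact: lspan_subspace. Qed.

Lemma env_prodM X Y u v : X u -> Y v -> env_prod X Y (u * v).
Proof. by move=> Xu Yv; apply: sub_lspan; exists u => //; exists v. Qed.

Lemma env_prod_min X Y Z : subspace Z ->
  (forall u v, X u -> Y v -> Z (u * v)) -> env_prod X Y `<=` Z.
Proof.
by move=> sZ XYZ; apply: lspan_sub => // _ [u Xu [v Yv <-]]; apply: XYZ.
Qed.

Lemma env_prodS X X' Y Y' :
  X `<=` X' -> Y `<=` Y' -> env_prod X Y `<=` env_prod X' Y'.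
Proof.
move=> XX' YY'; apply: env_prod_min; first exact: env_prod_subspace.
by move=> u v /XX' ? /YY' ?; apply: env_prodM.
Qed.

Lemma mulr_subspace X u : subspace X -> subspace [set w | X (w * u)].
Proof.
move=> sX; apply/subspaceP; split=> /= [|a v w Xv Xw].
  by rewrite mul0r; apply: subspace0.
by rewrite mulrDl -scalerAl; apply: subspaceZD.
Qed.

Lemma mull_subspace X u : subspace X -> subspace [set w | X (u * w)].
Proof.
move=> sX; apply/subspaceP; split=> /= [|a v w Xv Xw].
  by rewrite mulr0; apply: subspace0.
by rewrite mulrDr -scalerAr; apply: subspaceZD.
Qed.

Lemma env_prodA X Y Z : env_prod X (env_prod Y Z) = env_prod (env_prod X Y) Z.
Proof.
apply/seteqP; split; apply: env_prod_min; try exact: env_prod_subspace.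
  move=> u v Xu YZv.
  apply: (env_prod_min (mull_subspace u (env_prod_subspace _ Z)) _ YZv).
  by move=> w z Yw Zz /=; rewrite mulrA; do 2?[apply: env_prodM] => //.
move=> u v XYu Zv.
apply: (env_prod_min (mulr_subspace v (env_prod_subspace X _)) _ XYu).
by move=> w z Xw Yz /=; rewrite -mulrA; do 2?[apply: env_prodM] => //.
Qed.

Lemma env_sub_prod_sub A B C : A `<=` C -> B `<=` C ->
  env_prod (env_sub A) (env_sub B) `<=` env_sub C.
Proof.
move=> leAC leBC; apply: env_prod_min; first exact: env_sub_subspace.
by move=> u v /(env_subS leAC) ? /(env_subS leBC) ?; apply: env_subM.
Qed.

(* The spanning half of Poincare-Birkhoff-Witt: commuting z in A + B past a
   factor a in A leaves only the term [z, a], again in A + B. *)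
Lemma env_sub_sumset A B : subspace A -> subspace B -> lie_closed (sumset A B) ->
  env_sub (sumset A B) = env_prod (env_sub A) (env_sub B).
Proof.
move=> sA sB clAB; apply/seteqP; split; last first.
  by apply: env_sub_prod_sub; [apply: sub_sumsetl|apply: sub_sumsetr].
set S := env_prod _ _; have sS : subspace S by exact: env_prod_subspace.
have AS x u : A x -> S u -> S (env_in x * u).
  move=> Ax; apply: (env_prod_min (mull_subspace _ sS)) => v w Av Bw /=.
  rewrite mulrA; apply: env_prodM => //.
  by apply: env_subM => //; apply: env_sub_in.
(* Quantifying over all z inside [T] lets the induction on u in U(A) replace z by the bracket
   [z, x]. The second component, u v in [S], feeds [AS] when u is multiplied by x. *)
pose T := [set u | forall z v, sumset A B z -> env_sub B v ->
                     S (env_in z * (u * v)) /\ S (u * v)].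
have sT : subspace T.
  apply/subspaceP; split=> [z v _ _|a u u' Tu Tu' z v Cz Bv].
    by rewrite !(mul0r, mulr0); split; exact: (subspace0 sS).
  have [? ?] := Tu z v Cz Bv; have [? ?] := Tu' z v Cz Bv.
  by rewrite mulrDl -scalerAl mulrDr -scalerAr; split; exact: (subspaceZD sS).
have AT x u : A x -> T u -> T (env_in x * u).
  move=> Ax Tu z v Cz Bv; have [zu uv] := Tu z v Cz Bv.
  rewrite -!mulrA; split; last exact: AS.
  have -> : env_in z * (env_in x * (u * v)) =
            env_in x * (env_in z * (u * v)) + env_in (lie z x) * (u * v).
    by rewrite env_in_lie mulrBl -!mulrA addrC subrK.
  apply: (subspaceD sS); first exact: AS.
  by apply: (Tu _ v _ Bv).1; apply: clAB => //; apply: sub_sumsetl.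
(* For u = 1, split z = a + b: a is absorbed by U(A) on the left and b by U(B) next to v. *)
have T1 : T 1.
  move=> z v [a Aa [b Bb <-]] Bv; rewrite mul1r; split; last first.
    by rewrite -[v]mul1r; apply: env_prodM => //; exact: env_sub1.
  rewrite linearD mulrDl; apply: (subspaceD sS).
    by apply: env_prodM => //; apply: env_sub_in.
  rewrite -[_ * _]mul1r; apply: env_prodM; first exact: env_sub1.
  by apply: env_subM => //; apply: env_sub_in.
have subT u : env_sub A u -> T u.
  by move=> Au; rewrite -[u]mulr1; apply: (env_sub_stable sT AT).
have CS z u : sumset A B z -> S u -> S (env_in z * u).
  move=> Cz; apply: (env_prod_min (mull_subspace _ sS)) => v w Av Bw /=.
  exact: (subT v Av z w Cz Bw).1.
move=> u Cu; rewrite -[u]mulr1; apply: (env_sub_stable sS CS) => //.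
by rewrite -[1]mulr1; apply: env_prodM; apply: env_sub1.
Qed.

(** Both products equal U(A + B). This is the tool for moving one factor past another. *)
Lemma env_subC A B : subspace A -> subspace B -> lie_closed (sumset A B) ->
  env_prod (env_sub A) (env_sub B) = env_prod (env_sub B) (env_sub A).
Proof.
by move=> sA sB cl; rewrite -!env_sub_sumset // sumsetC.
Qed.

End Enveloping.


(** * Transfer of the plus-minus identity from U(L) to U(g) *)

Section Restriction.
Variables (F : fieldType) (g : lieAlgType F) (L : subLie g).

(** The universal property of U(L), applied to the inclusion of L into g followed by [env_in]. *)
Lemma env_val_exists :
  exists f : {lrmorphism env (subLieType L) -> env g},
    forall x, f (env_in x) = env_in (subLie_val x).
Proof.
pose phi (x : subLieType L) : env g := env_in (subLie_val x).
have phiP : linear phi by move=> a x y; rewrite /phi !linearP.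
pose phiL := GRing.isLinear.Build F (subLieType L) (env g) *:%R phi phiP.
pose Phi : {linear subLieType L -> env g} := HB.pack phi phiL.
have Phi_lie x y : Phi (lie x y) = Phi x * Phi y - Phi y * Phi x.
  exact: env_in_lie.
by have [f [fE _]] := env_universal Phi_lie; exists f.
Qed.

(** The hypothesis lives in the enveloping algebra of L as a Lie algebra of its own; its image under
    the induced morphism is the required statement inside U(g). *)
Lemma env_sub_plus_minus (P M : set g) :
  plus_minus_pair [set x : subLieType L | P (subLie_val x)]
                  [set x : subLieType L | M (subLie_val x)] ->
  env_sub L `<=` env_prod (env_prod (env_sub P) (env_sub M)) (env_sub P).
Proof.
move=> [_ _ _ UL]; have [f fE] := env_val_exists.
have f_sub (A : set g) u :
    env_sub [set x : subLieType L | A (subLie_val x)] u -> env_sub A (f u).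
  have /subalgebraP[A1 sA AM] := env_sub_subalgebra A.
  move: u; apply: env_sub_min => [|x /= Ax]; last first.
    by rewrite fE; apply: env_sub_in.
  apply/subalgebraP; split=> /= [||u v Au Av]; first by rewrite rmorph1.
    apply/subspaceP; split=> /= [|a u v Au Av].
      by rewrite linear0; exact: (subspace0 sA).
    by rewrite linearP; exact: (subspaceZD sA).
  by rewrite rmorphM; apply: AM.
have f_prod X Y X' Y' :
    (forall u, X u -> X' (f u)) -> (forall u, Y u -> Y' (f u)) ->
    forall u, env_prod X Y u -> env_prod X' Y' (f u).
  move=> fX fY; apply: env_prod_min => [|u v Xu Yv] /=.
    have sXY := env_prod_subspace X' Y'.
    apply/subspaceP; split=> /= [|a u v Au Av].
      by rewrite linear0; exact: (subspace0 sXY).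
    by rewrite linearP; exact: (subspaceZD sXY).
  by rewrite rmorphM; apply: env_prodM; [apply: fX|apply: fY].
(* The range of [f] is a subalgebra containing the generators of U(L), so each element of U(L) is
   the image of a product expression. *)
suff: env_sub L `<=` range f.
  move=> Lf u /Lf[v _ <-].
  have : setT v by [].
  rewrite UL.
  by apply: (f_prod _ _ _ _ _ (f_sub P)); apply: f_prod => w; apply: f_sub.
apply: env_sub_min => [|x Lx].
  apply/subalgebraP; split=> [||_ _ [u _ <-] [v _ <-]].
  - by exists 1; rewrite ?rmorph1.
  - apply/subspaceP; split=> [|a _ _ [u _ <-] [v _ <-]].
      by exists 0; rewrite ?linear0.
    by exists (a *: u + v); rewrite ?linearP.
  - by exists (u * v); rewrite ?rmorphM.
have Lx' : subLie_pred L x by apply: mem_set.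
by exists (env_in (SubLieElt Lx')); rewrite ?fE.
Qed.

End Restriction.

(** * Bilinearity of the bracket, and subalgebras normalizing one another *)

Section LieProduct.
Variables (F : fieldType) (g : lieAlgType F).
Implicit Types A B : set g.

Lemma lieDl (x y z : g) : lie (x + y) z = lie x z + lie y z.
Proof. by rewrite -[x]scale1r lie_linearl !scale1r. Qed.

Lemma lieDr (x y z : g) : lie z (x + y) = lie z x + lie z y.
Proof. by rewrite -[x]scale1r lie_linearr !scale1r. Qed.

Lemma lieC (x y : g) : lie x y = - lie y x.
Proof.
have := liexx (x + y); rewrite lieDl !lieDr !liexx add0r addr0 => /eqP.
by rewrite addr_eq0 => /eqP.
Qed.

Lemma lie0r (x : g) : lie x 0 = 0.
Proof. by apply: (addIr (lie x 0)); rewrite -lieDr !add0r. Qed.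

Lemma lie0l (x : g) : lie 0 x = 0.
Proof. by rewrite lieC lie0r oppr0. Qed.

(** Of the four brackets, only [A, A] falls in [A]; the two mixed ones and [B, B] fall in [B]. *)
Lemma lie_closed_sumset A B : subspace B -> lie_closed A -> lie_closed B ->
  (forall x y, A x -> B y -> B (lie x y)) -> lie_closed (sumset A B).
Proof.
move=> sB clA clB AB _ _ [x Ax [y By <-]] [x' Ax' [y' By' <-]].
rewrite lieDl !lieDr -addrA; exists (lie x x'); first exact: clA.
exists (lie x y' + (lie y x' + lie y y')) => //.
apply: (subspaceD sB); first exact: AB.
apply: (subspaceD sB); last exact: clB.
by rewrite lieC; apply: (subspaceN sB); apply: AB.
Qed.

End LieProduct.

(** * Sums of homogeneous components over a set of degrees *)

Section GradedParts.
Variables (n : nat) (F : fieldType) (g : lieAlgType F) (gr : 'rV[int]_n -> set g).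
Hypothesis gr_graded : Q_graded gr.
Implicit Types S T U : set 'rV[int]_n.

Let gr_subspace a : subspace (gr a).
Proof. by have [sgr _ _] := gr_graded; apply: sgr. Qed.

Lemma graded_part_subspace S : subspace (graded_part gr S).
Proof. exact: lspan_subspace. Qed.

Lemma sub_graded_part S a : S a -> gr a `<=` graded_part gr S.
Proof. by move=> Sa x ax; apply: sub_lspan; exists a. Qed.

Lemma graded_part_min S (C : set g) :
  subspace C -> (forall a, S a -> gr a `<=` C) -> graded_part gr S `<=` C.
Proof. by move=> sC SC; apply: lspan_sub => // x [a /SC]; apply. Qed.

(** Degrees that are not weights contribute only 0. Dropping the weight condition leaves index sets
    defined by coordinates alone, whose closure under addition can be checked. *)
Lemma graded_part_weights S :
  graded_part gr [set a | weights gr a /\ S a] = graded_part gr S.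
Proof.
apply/seteqP; split; apply: graded_part_min; try exact: graded_part_subspace.
  by move=> a [_ Sa]; apply: sub_graded_part.
move=> a Sa; have [wa|nwa] := pselect (weights gr a).
  exact: sub_graded_part.
have -> : gr a = [set 0] by apply: contrapT.
by move=> _ ->; exact: (subspace0 (graded_part_subspace _)).
Qed.

Lemma graded_partU S T :
  graded_part gr (S `|` T) = sumset (graded_part gr S) (graded_part gr T).
Proof.
have sP := graded_part_subspace.
apply/seteqP; split.
  apply: graded_part_min; first exact: sumset_subspace.
  move=> a [Sa|Ta] x ax.
    by apply: sub_sumsetl => //; apply: sub_graded_part ax.
  by apply: sub_sumsetr => //; apply: sub_graded_part ax.
apply: sumset_sub => //; apply: graded_part_min => // a aST.
  by apply: sub_graded_part; left.
by apply: sub_graded_part; right.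
Qed.

Lemma graded_partT : graded_part gr setT = setT.
Proof. by have [_ [-> _] _] := gr_graded. Qed.

Lemma graded_part1 a : graded_part gr [set a] = gr a.
Proof.
apply/seteqP; split; last exact: sub_graded_part.
by apply: graded_part_min => // _ ->.
Qed.

(** By bilinearity it suffices to bracket homogeneous elements. Closure and normalization are thus
    read off from sums of degrees. *)
Lemma graded_part_lie S T U :
  (forall a b, S a -> T b -> U (a + b)) ->
  forall x y, graded_part gr S x -> graded_part gr T y ->
    graded_part gr U (lie x y).
Proof.
have sU := graded_part_subspace U.
move=> STU x y Sx; move: y; apply: graded_part_min => [|b Tb y by_].
  apply/subspaceP; split=> /= [|c y z Uy Uz].
    by rewrite lie0r; exact: (subspace0 sU).
  by rewrite lie_linearr; exact: (subspaceZD sU).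
move: x Sx; apply: graded_part_min => [|a Sa x ax] /=.
  apply/subspaceP; split=> /= [|c x z Ux Uz].
    by rewrite lie0l; exact: (subspace0 sU).
  by rewrite lie_linearl; exact: (subspaceZD sU).
have [_ _ gr_lie] := gr_graded.
by apply: (sub_graded_part (STU _ _ Sa Tb)); apply: gr_lie.
Qed.

Lemma graded_part_disj S T x : S `&` T = set0 ->
  graded_part gr S x -> graded_part gr T x -> x = 0.
Proof. by have [_ dgr _] := gr_graded; apply: dsum_disj gr_subspace dgr. Qed.

End GradedParts.

(** * Positive, negative and flat degrees *)

Section Weights.
Variable n : nat.
Implicit Types a b : 'rV[int]_n.+1.

(** The bound [k] is on the position of the last nonzero coordinate, counted from 0: k = 0 gives all
    positive degrees, k = 1 those outside Z [alpha1]. *)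
Definition pos_from (k : nat) : set 'rV[int]_n.+1 :=
  [set a | exists i : 'I_n.+1, [/\ (k <= i)%N, 0 < a 0 i &
                                  forall j : 'I_n.+1, (i < j)%N -> a 0 j = 0]].

Definition neg_from (k : nat) : set 'rV[int]_n.+1 := [set a | pos_from k (- a)].

(** This is the line Z [alpha1]; see [flatE]. *)
Definition flat : set 'rV[int]_n.+1 :=
  [set a | forall j : 'I_n.+1, (0 < j)%N -> a 0 j = 0].

Lemma positive_from : @positive n.+1 = pos_from 0.
Proof.
by apply/seteqP; split=> a [i]; [move=> [? ?]|move=> [_ ? ?]]; exists i.
Qed.

Lemma negative_from : @negative n.+1 = neg_from 0.
Proof.
apply/seteqP; split=> a [i].
  move=> [ai a0]; exists i; split=> // [|j /a0]; rewrite mxE ?oppr_gt0 //.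
  by move=> ->; rewrite oppr0.
move=> [_]; rewrite mxE oppr_gt0 => ai a0; exists i; split=> // j /a0.
by rewrite mxE => /eqP; rewrite oppr_eq0 => /eqP.
Qed.

(** The later of the two last nonzero coordinates survives in the sum; at equal positions two
    positive integers add up. *)
Lemma pos_fromD k a b : pos_from k a -> pos_from k b -> pos_from k (a + b).
Proof.
move=> [i [ki ai a0]] [j [kj bj b0]].
have [ij|ji|/val_inj ij] := ltngtP i j.
- exists j; split=> // [|l jl]; first by rewrite mxE a0 // add0r.
  by rewrite mxE a0 ?b0 ?addr0 // (ltn_trans ij).
- exists i; split=> // [|l il]; first by rewrite mxE b0 // addr0.
  by rewrite mxE a0 ?b0 ?addr0 // (ltn_trans ji).
- subst j; exists i; split=> // [|l il]; first by rewrite mxE addr_gt0.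
  by rewrite mxE a0 ?b0 ?addr0.
Qed.

Lemma neg_fromD k a b : neg_from k a -> neg_from k b -> neg_from k (a + b).
Proof. by rewrite /neg_from /= opprD; apply: pos_fromD. Qed.

Lemma flatD a b : flat a -> flat b -> flat (a + b).
Proof. by move=> a0 b0 j j0; rewrite mxE a0 ?b0 ?addr0. Qed.

Lemma flatN a : flat a -> flat (- a).
Proof. by move=> a0 j j0; rewrite mxE a0 ?oppr0. Qed.

(** A flat degree only alters coordinate 0, which is not the last nonzero one of [b]. Hence the flat
    part of g normalizes [Np]. *)
Lemma flat_pos_fromD a b : flat a -> pos_from 1 b -> pos_from 1 (a + b).
Proof.
move=> a0 [i [i0 bi b0]]; exists i; split=> // [|l il].
  by rewrite mxE a0 // add0r.
by rewrite mxE b0 // a0 ?addr0 // (leq_ltn_trans _ il).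
Qed.

Lemma flat_neg_fromD a b : flat a -> neg_from 1 b -> neg_from 1 (a + b).
Proof.
by rewrite /neg_from /= opprD => /flatN; apply: flat_pos_fromD.
Qed.

Lemma pos_from0 k : ~ pos_from k 0.
Proof. by move=> [i [_]]; rewrite mxE ltxx. Qed.

Lemma pos_from1W : pos_from 1 `<=` pos_from 0.
Proof. by move=> a [i [_ ? ?]]; exists i. Qed.

Lemma pos_from_flat a : pos_from 0 a -> pos_from 1 a \/ flat a /\ 0 < a 0 0.
Proof.
move=> [i [_ ai a0]]; have [i0|] := posnP i; last by left; exists i.
right; split=> [j j0|]; first by apply: a0; rewrite i0.
by have <- : i = 0 by apply: val_inj.
Qed.

Lemma flat_pos_neg a : [\/ flat a, pos_from 1 a | neg_from 1 a].
Proof.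
have [/forallP a0|] := boolP [forall j : 'I_n.+1, (0 < j)%N ==> (a 0 j == 0)].
  by constructor 1 => j j0; apply/eqP; move: j0; apply/implyP.
rewrite negb_forall => /existsP[i0]; rewrite negb_imply => i0P.
(* [i] is the last nonzero coordinate; its sign decides between the two nonflat cases. *)
have [i /andP[i_gt0 ai] imax] :=
  arg_maxnP (P := fun j : 'I_n.+1 => (0 < j)%N && (a 0 j != 0))
    (@nat_of_ord n.+1) i0P.
have a0 (j : 'I_n.+1) : (i < j)%N -> a 0 j = 0.
  move=> ij; apply: contraTeq (ij) => aj; rewrite -leqNgt; apply: imax.
  by rewrite aj (leq_ltn_trans _ ij).
have [ai0|ai0|ai0] := ltrgtP (a 0 i) 0.
- constructor 3; exists i; split=> // [|j /a0 aj]; first by rewrite mxE oppr_gt0.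
  by rewrite mxE aj oppr0.
- by constructor 2; exists i.
- by rewrite ai0 eqxx in ai.
Qed.

Lemma flatE a : flat a -> a = delta_mx 0 0 *~ a 0 0.
Proof.
move=> a0; apply/rowP => j; rewrite -scaler_int !mxE intz eqxx.
have [->|j0] := eqVneq j 0; first by rewrite mulr1.
by rewrite mulr0 a0 // lt0n.
Qed.

End Weights.

(** * Factorization of U(g) and the resulting plus-minus pair *)

Theorem proposition3p3 (F : fieldType) (charF0 : [pchar F] =i pred0)
  (n : nat) (g : lieAlgType F) (gr : 'rV[int]_n.+1 -> set g)
  (gr_graded : Q_graded gr)
  (alpha1 := delta_mx 0 0 : 'rV[int]_n.+1)
  (* (1) *)
  (weights_line :
     [set alpha1 *~ k | k in [set: int]] `&` weights gr
     = [set 0; alpha1; - alpha1])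
  (* (2) *)
  (L : subLie g)
  (L_def : dsum_seq
     [:: gr alpha1; lie_span (gr alpha1) (gr (- alpha1)); gr (- alpha1)] L)
  (L_pm : plus_minus_pair
     [set x : subLieType L | gr alpha1 (subLie_val x)]
     [set x : subLieType L | gr (- alpha1) (subLie_val x)])
  (* (3) *)
  (g0' : set g) (g0'_subalgebra : lie_subalgebra g0')
  (g0_def : dsum_seq [:: lie_span (gr alpha1) (gr (- alpha1)); g0'] (gr 0)) :
  let g_plus := graded_part gr [set a | weights gr a /\ positive a] in
  let g_minus := graded_part gr [set a | weights gr a /\ negative a] in
  let P := sumset g_plus g0' in
  [/\ setT = env_prod (env_prod (env_prod
               (env_sub (gr alpha1)) (env_sub g_minus))
               (env_sub g0')) (env_sub g_plus),
      dsum_seq [:: g_plus; g0'] P &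
      plus_minus_pair P g_minus].
Proof.
have [sgr _ gr_lie] := gr_graded.
have [sg0' cl_g0'] := g0'_subalgebra.
have [sL cl_L] := subLieP L.
have sG := graded_part_subspace gr.
move=> g_plus g_minus P.
set E := gr alpha1 in L_def L_pm g0_def *.
set Fm := gr (- alpha1) in L_def L_pm g0_def *.
set H := lie_span E Fm in L_def g0_def *.
have sE : subspace E by exact: sgr.
have sFm : subspace Fm by exact: sgr.
have EL : E `<=` L := dsum_seq_sub (i := 0) L_def isT.
have HL : H `<=` L := dsum_seq_sub (i := 1) L_def isT.
have FmL : Fm `<=` L := dsum_seq_sub (i := 2) L_def isT.
have Hg0 : H `<=` gr 0 := dsum_seq_sub (i := 0) g0_def isT.
have g0'g0 : g0' `<=` gr 0 := dsum_seq_sub (i := 1) g0_def isT.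
(* [Np] and [Nm] are N+ and N-; [K] collects the degrees on Z [alpha1] and will turn out to be L +
   g0'. *)
pose Np := graded_part gr (pos_from 1).
pose Nm := graded_part gr (neg_from 1).
pose K := graded_part gr (@flat n).
have sNp : subspace Np := sG _.
have sNm : subspace Nm := sG _.
have sK : subspace K := sG _.
have flat0 : flat (0 : 'rV[int]_n.+1) by move=> j _; rewrite mxE.
have flat1 : flat alpha1.
  by move=> j j0; rewrite mxE eqxx /= -val_eqE /= eqn0Ngt j0.
have gr_flat a x : flat a -> gr a x -> x = 0 \/ [set 0; alpha1; - alpha1] a.
  move=> fa ax; have [wa|nwa] := pselect (weights gr a).
    right; rewrite -weights_line; split=> //.
    by exists (a 0 0) => //; rewrite [RHS]flatE.
  by left; have grE : gr a = [set 0] by [apply: contrapT]; move: ax; rewrite grE.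
have alpha11 : alpha1 0 0 = 1 by rewrite mxE !eqxx.
have pos_alpha1 : pos_from 0 alpha1.
  by exists 0; split=> //; rewrite alpha11.
have neg_alpha1 : neg_from 0 (- alpha1) by rewrite /neg_from /= opprK.
have g_plusE' : g_plus = graded_part gr (pos_from 0).
  by rewrite /g_plus graded_part_weights positive_from.
have g_minusE' : g_minus = graded_part gr (neg_from 0).
  by rewrite /g_minus graded_part_weights negative_from.
(* By (1), [alpha1] is the only positive weight on the line. *)
have g_plusE : g_plus = sumset E Np.
  rewrite g_plusE'; apply/seteqP; split.
    apply: graded_part_min; first exact: sumset_subspace.
    move=> a /pos_from_flat[a1|[fa a0]] x ax.
      by apply: sub_sumsetr => //; apply: sub_graded_part ax.
    have [->|[[a00|aE]|aN]] := gr_flat _ _ fa ax.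
    - exact: (subspace0 (sumset_subspace sE (sG _))).
    - by rewrite a00 mxE in a0.
    - by apply: sub_sumsetl => //; rewrite /E -aE.
    - by rewrite aN mxE alpha11 in a0.
  apply: sumset_sub => //; first exact: sub_graded_part.
  by apply: graded_part_min => // a /pos_from1W; apply: sub_graded_part.
have g_minusE : g_minus = sumset Nm Fm.
  rewrite g_minusE'; apply/seteqP; split.
    apply: graded_part_min; first exact: sumset_subspace.
    move=> a /pos_from_flat[a1|[/flatN fa a0]] x ax; last rewrite opprK in fa.
      by apply: sub_sumsetl => //; apply: sub_graded_part ax.
    have [->|[[a00|aE]|aN]] := gr_flat _ _ fa ax.
    - exact: (subspace0 (sumset_subspace (sG _) sFm)).
    - by rewrite a00 !mxE in a0.
    - by rewrite aE mxE alpha11 in a0.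
    - by apply: sub_sumsetr => //; rewrite /Fm -aN.
  apply: sumset_sub => //; last exact: sub_graded_part.
  by apply: graded_part_min => // a a1; apply: sub_graded_part; apply: pos_from1W.
(* By (1) only the degrees 0, [alpha1] and - [alpha1] matter; by (3) degree 0 splits into [H],
   inside L, and [g0']. *)
have KE : K = sumset L g0'.
  have sLg := sumset_subspace sL sg0'.
  apply/seteqP; split; last first.
    apply: sumset_sub => //; last first.
      by move=> x /g0'g0; apply: sub_graded_part.
    apply: (dsum_seq_min L_def) => // -[|[|[|//]]] _ /=.
    - exact: sub_graded_part.
    - by move=> x /Hg0; apply: sub_graded_part.
    - by apply: sub_graded_part; apply: flatN.
  apply: graded_part_min => // a fa x ax.
  have [->|[[a0|aE]|aN]] := gr_flat _ _ fa ax.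
  - exact: subspace0 sLg.
  - rewrite a0 in ax; move: x ax.
    apply: (dsum_seq_min g0_def) => // -[|[|//]] _ /=.
      by move=> x /HL; apply: sub_sumsetl.
    exact: sub_sumsetr.
  - by apply: sub_sumsetl => //; apply: EL; rewrite /E -aE.
  - by apply: sub_sumsetl => //; apply: FmL; rewrite /Fm -aN.
have gE : setT = sumset Nm (sumset K Np).
  rewrite -graded_partU -graded_partU -(graded_partT gr_graded).
  congr graded_part; apply/seteqP; split=> // a _.
  by have [?|?|?] := flat_pos_neg a; [right; left|right; right|left].
have cl_pos k : lie_closed (graded_part gr (pos_from k)).
  by move=> x y; apply: graded_part_lie => // a b; apply: pos_fromD.
have cl_neg k : lie_closed (graded_part gr (neg_from k)).
  by move=> x y; apply: graded_part_lie => // a b; apply: neg_fromD.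
have cl_K : lie_closed K.
  by move=> x y; apply: graded_part_lie => // a b; apply: flatD.
have cl_KNp : lie_closed (sumset K Np).
  apply: lie_closed_sumset => //; first exact: cl_pos.
  by move=> x y; apply: graded_part_lie => // a b; apply: flat_pos_fromD.
(* Being a subalgebra is part of the plus-minus pair of L, where brackets are those of g. *)
have cl_E : lie_closed E.
  move=> x y Ex Ey; have [[_ clE] _ _ _] := L_pm.
  have Lx : subLie_pred L x by apply/mem_set/EL.
  have Ly : subLie_pred L y by apply/mem_set/EL.
  exact: (clE (SubLieElt Lx) (SubLieElt Ly)).
(* This closure and the next one license the two exchanges of U(E) through [env_subC]. *)
have cl_ENm : lie_closed (sumset E Nm).
  apply: lie_closed_sumset => //; first exact: cl_neg.
  move=> x y Ex; apply: (graded_part_lie gr_graded (S := [set alpha1])) => //.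
    by move=> _ b ->; apply: flat_neg_fromD.
  exact: sub_graded_part Ex.
have cl_g0'E : lie_closed (sumset g0' E).
  apply: lie_closed_sumset => // x y /g0'g0 g0x Ey.
  by rewrite /E -[alpha1]add0r; apply: gr_lie.
have cl_P : lie_closed P.
  rewrite /P sumsetC g_plusE'; apply: lie_closed_sumset => //.
  move=> x y /g0'g0; rewrite -(graded_part1 gr_graded).
  apply: graded_part_lie => //.
  by move=> _ b ->; rewrite add0r.
have UE : setT = env_prod (env_prod (env_prod
               (env_sub E) (env_sub g_minus)) (env_sub g0')) (env_sub g_plus).
  have -> : env_sub g_minus = env_prod (env_sub Nm) (env_sub Fm).
    by rewrite g_minusE env_sub_sumset // -g_minusE g_minusE'.
  have -> : env_sub g_plus = env_prod (env_sub E) (env_sub Np).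
    by rewrite g_plusE env_sub_sumset // -g_plusE g_plusE'.
  apply/seteqP; split=> // u _.
  have : env_sub [set: g] u by rewrite env_subT.
  rewrite gE env_sub_sumset //; [|exact: sumset_subspace|by rewrite -gE].
  rewrite env_sub_sumset // KE env_sub_sumset //; last by rewrite -KE.
  (* Monotonicity replaces U(L) by U(E) U(Fm) U(E) inside U(Nm) U(L) U(g0') U(Np). *)
  have /(env_prodS (fun x xP => xP)) := env_prodS (env_prodS (env_sub_plus_minus L_pm)
    (fun x (xP : env_sub g0' x) => xP)) (fun x (xP : env_sub Np x) => xP).
  move=> /(_ (env_sub Nm)) le /le.
  (* The second U(E) passes U(g0') to meet U(Np); then the first passes U(Nm) to the far left. *)
  rewrite -(env_prodA _ (env_sub E) (env_sub g0')).
  rewrite (env_subC (A := E) (B := g0')) // ?[sumset E g0']sumsetC //.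
  by rewrite !env_prodA (env_subC (A := Nm) (B := E)) // ?[sumset Nm E]sumsetC.
have g_plus_g0' x : g_plus x -> g0' x -> x = 0.
  rewrite g_plusE' => px /g0'g0; rewrite -(graded_part1 gr_graded).
  apply: (graded_part_disj gr_graded _ px).
  by rewrite -subset0 => a [pa a0]; rewrite a0 in pa; exact: (pos_from0 pa).
have sg_plus : subspace g_plus by exact: sG.
split=> //; first exact: dsum_seq2.
split=> [|||]; first by split=> //; apply: sumset_subspace.
- by split; [exact: sG|rewrite g_minusE'].
(* Write h = p + q + m along g+, g0', g-. Then h - q = p + m has degree 0 and also only nonzero
   degrees, so it vanishes, and h = q lies in both summands of [gr 0]. *)
- move=> PM; have H0 h : H h -> h = 0.
    move=> Hh; have : setT h by [].
    rewrite -PM => -[_ [p pp [q qq <-]] [m mm hE]].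
    have pm : p + m = h - q by rewrite -hE addrAC addrK.
    suff h0 : h - q = 0.
      apply: (dsum_seq2_disj sg0' g0_def) => //.
      by move/eqP: h0; rewrite subr_eq0 => /eqP ->.
    have hq : gr 0 (h - q).
      apply: (subspaceD (sgr 0)); first exact: Hg0.
      by apply: (subspaceN (sgr 0)); apply: g0'g0.
    apply: (graded_part_disj gr_graded
              (S := pos_from 0 `|` neg_from 0) (T := [set 0])).
    + rewrite -subset0 => a [[pa|na] a0].
        by rewrite a0 in pa; exact: (pos_from0 pa).
      by rewrite a0 /neg_from /= oppr0 in na; exact: (pos_from0 na).
    + rewrite -pm graded_partU -g_plusE' -g_minusE'.
      by exists p => //; exists m.
    + by rewrite graded_part1.
  (* With [H] zero, L is spanned by [E] and [Fm], against the properness required of its plus-minus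
     pair. *)
  have [_ _ nPM _] := L_pm; apply: nPM; apply/seteqP; split=> // x _.
  have Lx : subLie_set L (subLie_val x) by apply/set_mem/subLie_valP.
  have : sumset E Fm (subLie_val x).
    move: Lx; apply: (dsum_seq_min L_def); first exact: sumset_subspace.
    move=> -[|[|[|//]]] _ /=; first exact: sub_sumsetl.
      by move=> h /H0 ->; exact: (subspace0 (sumset_subspace sE sFm)).
    exact: sub_sumsetr.
  move=> [e Ee [f Ff xE]].
  have Le : subLie_pred L e by apply/mem_set/EL.
  have Lf : subLie_pred L f by apply/mem_set/FmL.
  exists (SubLieElt Le) => //; exists (SubLieElt Lf) => //.
  by apply: val_inj; rewrite raddfD.
(* Bracketed as (U(E) U(g-)) (U(g0') U(g+)), the outer factors fall into U(P), since [E] lies in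
   g+. *)
- apply/seteqP; split=> // u; rewrite {1}UE -env_prodA.
  apply: env_prodS; last first.
    by apply: env_sub_prod_sub; [apply: sub_sumsetr|apply: sub_sumsetl].
  apply: env_prodS => //; apply: env_subS.
  by move=> x Ex; apply: sub_sumsetl => //; rewrite g_plusE; apply: sub_sumsetl.
Qed.
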